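(* Let $A$ be a T-brace which is Smoktunowicz-nilpotent, and suppose that the upper $\star$-central series of $A$ has length $k$ for some positive integer $k$ (i.e. $\zeta_k(\star,A)=A$ and $\zeta_{k-1}(\star,A)\neq A$). If the additive group of $A$ is not periodic, then for every prime $p$ the Sylow $p$-subgroup of the additive group of $K=A\star A$ is finite of order at most $p^{k-1}$.
   Context: A (left) brace is a set $A$ with two operations $+$ and $\cdot$ such that $(A,+)$ is an abelian group, $(A,\cdot)$ is a group, and $a(b+c)=ab+ac-a$ for all $a,b,c\in A$. Put $a\star b=ab-a-b$; for subsets $K,L$, $K\star L$ is the subgroup of $(A,+)$ generated by all $x\star y$, $x\in K$, $y\in L$. A subbrace is a subset which is a subgroup of both $(A,+)$ and $(A,\cdot)$; a subbrace $L$ is an ideal if $a\star z, z\star a\in L$ for all $a\in A$, $z\in L$, and then the quotient brace $A/L$ is defined. $A$ is a T-brace if whenever $I$ is an ideal of $J$ and $J$ is an ideal of $A$, then $I$ is an ideal of $A$. The $\star$-center is $\zeta(\star,A)=\{a: a\star x=x\star a=0\ \forall x\}$; the upper $\star$-central series is $\zeta_0(\star,A)=0$, $\zeta_{\alpha+1}(\star,A)/\zeta_\alpha(\star,A)=\zeta(\star,A/\zeta_\alpha(\star,A))$, unions at limit ordinals. Define $A^{(1)}=A$, $A^{(n+1)}=A^{(n)}\star A$, $A^1=A$, $A^{n+1}=A\star A^n$; $A$ is Smoktunowicz-nilpotent if $A^{(n)}=A^m=0$ for some natural numbers $n,m$ (equivalently, $\zeta_j(\star,A)=A$ for some finite $j$).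 *)

(* Defs.v *)
From mathcomp Require Import all_boot all_order all_algebra.
Set Implicit Arguments. Unset Strict Implicit. Unset Printing Implicit Defensive.
Import GRing.Theory.
Local Open Scope ring_scope.

Section Brace.
Variable A : zmodType.

Record is_brace (mul : A -> A -> A) (one : A) (inv : A -> A) : Prop := {
  brace_mulA : forall a b c, mul a (mul b c) = mul (mul a b) c;
  brace_mul1l : forall a, mul one a = a;
  brace_mul1r : forall a, mul a one = a;
  brace_mulVl : forall a, mul (inv a) a = one;
  brace_mulVr : forall a, mul a (inv a) = one;
  brace_law : forall a b c, mul a (b + c) = mul a b + mul a c - a
}.

Variable mul : A -> A -> A.
Variable one : A.
Variable inv : A -> A.

Definition star (a b : A) : A := mul a b - a - b.

Definition setA : A -> Prop := fun _ => True.

Definition add_subgroup (H : A -> Prop) : Prop :=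
  H 0 /\ (forall x y, H x -> H y -> H (x - y)).

Definition mul_subgroup (H : A -> Prop) : Prop :=
  H one /\ (forall x y, H x -> H y -> H (mul x y)) /\ (forall x, H x -> H (inv x)).

Definition add_gen (S : A -> Prop) : A -> Prop :=
  fun x => forall H, add_subgroup H -> (forall y, S y -> H y) -> H x.

Definition star_set (K L : A -> Prop) : A -> Prop :=
  add_gen (fun z => exists x y, K x /\ L y /\ z = star x y).

Definition subbrace (L : A -> Prop) : Prop := add_subgroup L /\ mul_subgroup L.

Definition ideal_of (J I : A -> Prop) : Prop :=
  subbrace I /\ (forall z, I z -> J z) /\
  (forall a z, J a -> I z -> I (star a z) /\ I (star z a)).

Definition ideal (I : A -> Prop) : Prop := ideal_of setA I.

Definition T_brace : Prop :=
  forall I J : A -> Prop, ideal_of J I -> ideal J -> ideal I.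

(* finite levels of the upper star-central series:
   zeta 0 = 0, zeta (n+1) / zeta n = star-center of A / zeta n, i.e.
   a in zeta (n+1) iff a*x and x*a lie in zeta n for all x *)
Fixpoint zeta (n : nat) : A -> Prop :=
  match n with
  | 0%N => fun a => a = 0
  | n'.+1 => fun a => forall x, zeta n' (star a x) /\ zeta n' (star x a)
  end.

(* rpow n = A^(n+1) with A^(1) = A, A^(n+1) = A^(n) * A;
   lpow n = A^{n+1} with A^1 = A, A^{n+1} = A * A^n *)
Fixpoint rpow (n : nat) : A -> Prop :=
  match n with 0%N => setA | n'.+1 => star_set (rpow n') setA end.
Fixpoint lpow (n : nat) : A -> Prop :=
  match n with 0%N => setA | n'.+1 => star_set setA (lpow n') end.

Definition is_zero_set (S : A -> Prop) : Prop := forall x, S x -> x = 0.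

Definition smok_nilpotent : Prop :=
  (exists n, is_zero_set (rpow n)) /\ (exists m, is_zero_set (lpow m)).

End Brace.

Definition add_periodic (A : zmodType) : Prop :=
  forall a : A, exists n : nat, (0 < n)%N /\ a *+ n = 0.

Definition sylow_part (A : zmodType) (p : nat) (K : A -> Prop) : A -> Prop :=
  fun x => K x /\ exists e : nat, x *+ (p ^ e) = 0.

Definition finite_card_le (A : zmodType) (S : A -> Prop) (N : nat) : Prop :=
  exists s : seq A, uniq s /\ (forall x, S x <-> x \in s) /\ (size s <= N)%N.

(* Main.v *)
Require Import Defs.
From mathcomp Require Import all_boot all_order all_algebra zify.
From Stdlib Require Import Classical.
Set Implicit Arguments. Unset Strict Implicit. Unset Printing Implicit Defensive.
Import GRing.Theory.
Local Open Scope ring_scope.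

(** In a nilpotent T-brace every subbrace is a subideal, hence an ideal. So
    [a * x] and [x * a] lie in the subbrace [<a>], which is [Z a + <a> * <a>].
    Climbing the upper central series this forces [A * A] to be torsion, and the
    star-center to contain an element [z] of infinite order when [A] is not
    periodic. If [a] has infinite order the component of [a * x] on [a] must
    vanish; otherwise replace [a] by [a + z]. Hence [a * x] and [x * a] lie in
    [<a> * <a>] for all [a] and [x].
    Put [L_0 = A] and [L_(i+1) = L_i * L_i]; then [L_i] is contained in
    [zeta_(k-i)], and the star product induces biadditive maps
    [L_i / L_(i+1) x L_i / L_(i+1) -> L_(i+1) / L_(i+2)]. For [i = 0] the value at
    [(a, x)] is a multiple of the value at [(a, a)] and of the value at [(x, x)],
    which makes the p-part of [L_1 / L_2] cyclic of order at most [p]; by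
    biadditivity this property passes from each layer to the next. As [L_k = 0],
    the p-part of [L_1] has order at most [p ^ (k - 1)]. *)

(** * Equations in abelian groups by reflection *)

Section AbelianGroupEquations.

Inductive zexp := ZVar of nat | ZNul | ZSum of zexp & zexp | ZOpp of zexp.

Fixpoint zval (V : zmodType) (env : seq V) e : V :=
  match e with
  | ZVar n => env`_n
  | ZNul => 0
  | ZSum e f => zval env e + zval env f
  | ZOpp e => - zval env e
  end.

Fixpoint zcoef e (i : nat) : int :=
  match e with
  | ZVar n => if i == n then 1 else 0
  | ZNul => 0
  | ZSum e f => zcoef e i + zcoef f i
  | ZOpp e => - zcoef e i
  end.

Lemma zvalE (V : zmodType) (env : seq V) e :
  zval env e = \sum_(i < size env) env`_i *~ zcoef e i.
Proof.
elim: e => [n||e IHe f IHf|e IHe] /=.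
- have [lt_n|le_n] := ltnP n (size env).
    rewrite (bigD1 (Ordinal lt_n)) //= eqxx mulr1z big1 ?addr0 // => i.
    by rewrite -val_eqE /= => /negbTE ->; rewrite mulr0z.
  rewrite nth_default // big1 // => i _.
  by rewrite ltn_eqF ?mulr0z // (leq_trans (ltn_ord i)).
- by rewrite big1 // => i _; rewrite mulr0z.
- by rewrite IHe IHf -big_split; apply: eq_bigr => i _; rewrite mulrzDr.
- by rewrite IHe -sumrN; apply: eq_bigr => i _; rewrite mulrNz.
Qed.

Lemma zval_eq (V : zmodType) (env : seq V) e f :
  all (fun i => zcoef e i == zcoef f i) (iota 0 (size env)) ->
  zval env e = zval env f.
Proof.
move=> /allP ef; rewrite !zvalE; apply: eq_bigr => i _.
by rewrite (eqP (ef i _)) // mem_iota /=.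
Qed.

End AbelianGroupEquations.

Ltac zmod_mem x env :=
  match env with
  | nil => constr:(false)
  | x :: _ => constr:(true)
  | _ :: ?env' => zmod_mem x env'
  end.

Ltac zmod_env env t :=
  match t with
  | 0%R => env
  | (?a + ?b)%R => let env' := zmod_env env a in zmod_env env' b
  | (- ?a)%R => zmod_env env a
  | _ => match zmod_mem t env with true => env | false => constr:(t :: env) end
  end.

Ltac zmod_index x env :=
  match env with
  | x :: _ => constr:(0%N)
  | _ :: ?env' => let n := zmod_index x env' in constr:(S n)
  end.

Ltac zmod_reify env t :=
  match t with
  | 0%R => constr:(ZNul)
  | (?a + ?b)%R =>
    let e := zmod_reify env a in let f := zmod_reify env b in constr:(ZSum e f)
  | (- ?a)%R => let e := zmod_reify env a in constr:(ZOpp e)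
  | _ => let n := zmod_index t env in constr:(ZVar n)
  end.

(* Decides, by reflection, the equations that hold in every abelian group. *)
Ltac zmod :=
  lazymatch goal with
  | |- @eq ?V ?a ?b =>
    let env := zmod_env (@nil V) a in
    let env := zmod_env env b in
    let e := zmod_reify env a in
    let f := zmod_reify env b in
    change (zval env e = zval env f); apply: zval_eq; vm_compute; reflexivity
  end.

(** * Additive subgroups, congruences and torsion *)

Section Subgroups.

Variable A : zmodType.
Implicit Types (H S : A -> Prop) (x y z c : A).

Lemma subgroupB H x y : add_subgroup H -> H x -> H y -> H (x - y).
Proof. by case=> _ HB; apply: HB. Qed.

Lemma subgroupN H x : add_subgroup H -> H x -> H (- x).
Proof. by move=> hH Hx; rewrite -sub0r; apply: subgroupB (hH) (hH.1) Hx. Qed.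

Lemma subgroupD H x y : add_subgroup H -> H x -> H y -> H (x + y).
Proof. by move=> hH Hx Hy; rewrite -[y]opprK; apply: subgroupB (subgroupN _ _). Qed.

Lemma subgroupMn H x n : add_subgroup H -> H x -> H (x *+ n).
Proof.
move=> hH Hx; elim: n => [|n IHn]; first by rewrite mulr0n; apply: hH.1.
by rewrite mulrS; apply: subgroupD.
Qed.

Lemma subgroupMz H x n : add_subgroup H -> H x -> H (x *~ n).
Proof.
by move=> hH Hx; case: n => n; [|apply: subgroupN => //]; apply: subgroupMn.
Qed.

Lemma eqmod_trans H y x z :
  add_subgroup H -> H (x - y) -> H (y - z) -> H (x - z).
Proof.
move=> hH Hxy Hyz; have -> : x - z = (x - y) + (y - z) by zmod.
exact: subgroupD.
Qed.

Lemma eqmod_sym H x y : add_subgroup H -> H (x - y) -> H (y - x).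
Proof. by move=> hH Hxy; rewrite -opprB; apply: subgroupN. Qed.

Lemma eqmodD H x y x' y' : add_subgroup H ->
  H (x - x') -> H (y - y') -> H ((x + y) - (x' + y')).
Proof.
move=> hH Hx Hy; have -> : x + y - (x' + y') = (x - x') + (y - y') by zmod.
exact: subgroupD.
Qed.

Lemma eqmodMz H x y n : add_subgroup H -> H (x - y) -> H (x *~ n - y *~ n).
Proof. by move=> hH Hxy; rewrite -mulrzBl; apply: subgroupMz. Qed.

Lemma eqmod_in H x y : add_subgroup H -> H (x - y) -> H y -> H x.
Proof. by move=> hH Hxy Hy; rewrite -(subrK y x); apply: subgroupD. Qed.

Lemma add_gen_subgroup S : add_subgroup (add_gen S).
Proof.
split=> [H hH _|x y Sx Sy H hH HS]; first exact: hH.1.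
by apply: subgroupB (hH) _ _; [apply: Sx | apply: Sy].
Qed.

(** The subgroup [H + Z c]: the preimage of a cyclic subgroup of the quotient by [H], without
    forming the quotient. *)
Definition mod_span H c y := exists n : int, H (y - c *~ n).

Lemma mod_span_subgroup H c : add_subgroup H -> add_subgroup (mod_span H c).
Proof.
move=> hH; split=> [|x y [n Hn] [m Hm]].
  by exists 0; rewrite mulr0z subr0; apply: hH.1.
exists (n - m); have -> : x - y - c *~ (n - m) = (x - c *~ n) - (y - c *~ m).
  by rewrite mulrzBr; zmod.
exact: subgroupB.
Qed.

Lemma mod_span_id H c : add_subgroup H -> mod_span H c c.
Proof. by move=> hH; exists 1; rewrite mulr1z subrr; apply: hH.1. Qed.

Lemma mod_span_sub H c y : H y -> mod_span H c y.
Proof. by move=> Hy; exists 0; rewrite mulr0z subr0. Qed.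

Definition torsion x := exists n : nat, (0 < n)%N /\ x *+ n = 0.

Lemma torsion_subgroup : add_subgroup torsion.
Proof.
split=> [|x y [n [n_gt0 nx]] [m [m_gt0 my]]]; first by exists 1%N.
exists (n * m)%N; split; first by rewrite muln_gt0 n_gt0.
by rewrite mulrnBl mulrnA nx mul0rn mulnC mulrnA my mul0rn subr0.
Qed.

Lemma torsionMn x n : (0 < n)%N -> torsion (x *+ n) -> torsion x.
Proof.
move=> n_gt0 [m [m_gt0 mx]]; exists (n * m)%N.
by rewrite muln_gt0 n_gt0 m_gt0 mulrnA.
Qed.

Lemma torsionMz x (n : int) : n != 0 -> torsion (x *~ n) -> torsion x.
Proof.
case: n => [[|n]|n] // _; first by apply: torsionMn.
move=> /(subgroupN torsion_subgroup).
by rewrite NegzE mulrNz opprK; apply: torsionMn.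
Qed.

End Subgroups.

(** * Star calculus and the upper central series *)

Section BraceArithmetic.

Variables (A : zmodType) (mul : A -> A -> A) (one : A) (inv : A -> A).
Hypothesis HB : is_brace mul one inv.

Local Notation "a ** b" := (star mul a b) (at level 40, left associativity).

Lemma brace_mulr0 a : mul a 0 = a.
Proof.
set m := mul a 0; have e : m = m + m - a.
  by rewrite {1}/m -{1}[0]addr0 (brace_law HB).
have -> : m = (m + m - a) - m + a by zmod.
by rewrite -e; zmod.
Qed.

Lemma brace_one : one = 0.
Proof. by rewrite -(brace_mulr0 one) (brace_mul1l HB). Qed.

Lemma brace_mulE a b : mul a b = a + b + a ** b.
Proof. by rewrite /star; zmod. Qed.

Lemma starDr a b c : a ** (b + c) = a ** b + a ** c.
Proof. by rewrite /star (brace_law HB); zmod. Qed.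

Lemma starr0 a : a ** 0 = 0.
Proof. by rewrite /star brace_mulr0; zmod. Qed.

Lemma star0r b : 0 ** b = 0.
Proof. by rewrite /star -brace_one (brace_mul1l HB) brace_one; zmod. Qed.

Lemma starNr a b : a ** (- b) = - (a ** b).
Proof. by apply/eqP; rewrite -addr_eq0 -starDr addrC subrr starr0. Qed.

Lemma starBr a b c : a ** (b - c) = a ** b - a ** c.
Proof. by rewrite starDr starNr. Qed.

Lemma starMnr a b n : a ** (b *+ n) = (a ** b) *+ n.
Proof.
by elim: n => [|n IHn]; rewrite ?mulr0n ?starr0 // !mulrS starDr IHn.
Qed.

Lemma starMzr a b n : a ** (b *~ n) = (a ** b) *~ n.
Proof.
by case: n => n; rewrite ?NegzE ?mulrNz ?starNr -!pmulrn starMnr.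
Qed.

(** Associativity of [mul] in terms of star; it stands in for additivity on the left, which fails in
    general. *)
Lemma star_mull a b c : mul a b ** c = a ** (b ** c) + b ** c + a ** c.
Proof.
have := congr1 (fun t => a ** t) (brace_mulE b c).
rewrite /= !starDr /star (brace_mulA HB) => /eqP; rewrite -subr_eq0 => /eqP e.
apply/eqP; rewrite -subr_eq0 -e; apply/eqP; zmod.
Qed.

(** Turns a sum into a product, so that [star_mull] applies to [(u + w) ** x]. *)
Lemma mul_add_inv u w : mul u (w + inv u ** w) = u + w.
Proof.
have := star_mull u (inv u) w; rewrite (brace_mulVr HB) brace_one star0r => e.
by rewrite brace_mulE starDr -[u + w]addr0 e; zmod.
Qed.

Lemma star_inv u : u ** inv u = - u - inv u.
Proof. by rewrite /star (brace_mulVr HB) brace_one; zmod. Qed.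

Lemma star_shift_inv (J : A -> Prop) u w x : add_subgroup J ->
  (forall a v, J v -> J (a ** v)) -> J ((w + inv u ** w) ** x) ->
  J ((u + w) ** x - u ** x).
Proof.
move=> hJ AJ Jx; rewrite -(mul_add_inv u w) star_mull addrK.
by apply: subgroupD => //; apply: AJ.
Qed.

Lemma star_shift (I J : A -> Prop) u w x : add_subgroup I -> add_subgroup J ->
  (forall a v, I v -> I (a ** v)) -> (forall v a, I v -> J (v ** a)) ->
  (forall a v, J v -> J (a ** v)) -> I w -> J ((u + w) ** x - u ** x).
Proof.
move=> hI hJ AI IA AJ Iw; apply: star_shift_inv => //.
by apply: IA; apply: subgroupD => //; apply: AI.
Qed.

(** Both sides are compared with [mul a b ** x]: [mul a b] differs from [a + b] by [a ** b], and by
    [star_mull] the remaining error is [a ** (b ** x)]. *)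
Lemma star_addl_mod (I J : A -> Prop) a b x :
  add_subgroup I -> add_subgroup J ->
  (forall u v, I v -> I (u ** v)) -> (forall v u, I v -> J (v ** u)) ->
  (forall u v, I v -> J (u ** v)) -> (forall u v, J v -> J (u ** v)) ->
  I (a ** b) -> I (b ** x) -> J ((a + b) ** x - (a ** x + b ** x)).
Proof.
move=> hI hJ AI IA AIJ AJ Iab Ibx.
apply: (eqmod_trans (y := mul a b ** x)) => //.
  apply: eqmod_sym => //; rewrite brace_mulE.
  exact: (star_shift (I := I)).
rewrite star_mull; have -> : a ** (b ** x) + b ** x + a ** x -
  (a ** x + b ** x) = a ** (b ** x) by zmod.
exact: AIJ.
Qed.

Lemma zeta_closed n :
  add_subgroup (zeta mul n) /\
  (forall a x, zeta mul n a -> zeta mul n (a ** x) /\ zeta mul n (x ** a)).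
Proof.
elim: n => [|n [hZ cZ]].
  split; first by split=> // x y -> ->; rewrite subr0.
  by move=> a x ->; rewrite star0r starr0.
have incl a : zeta mul n a -> zeta mul n.+1 a by move=> Za x; apply: cZ.
split; last by move=> a x Za; split; apply: incl; case: (Za x).
split=> [|a b Za Zb x]; first by apply: incl; apply: hZ.1.
split; last by rewrite starBr; apply: subgroupB hZ (Za x).2 (Zb x).2.
(* Closure under subtraction in the left argument: adding [b] back to [a - b] changes the product
   with [x] only modulo [zeta n]. *)
have h : zeta mul n ((a - b + b) ** x - (a - b) ** x).
  apply: star_shift_inv => //; first by move=> u v /(cZ _ u) [].
  apply: (eqmod_in (y := b ** x)) => //; last exact: (Zb x).1.
  apply: (star_shift (I := zeta mul n)) => //; last exact: (Zb (inv (a - b))).2.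
  - by move=> u v /(cZ _ u) [].
  - by move=> v u /(cZ _ u) [].
  - by move=> u v /(cZ _ u) [].
rewrite subrK in h; apply: (eqmod_in (y := a ** x)) => //; last exact: (Za x).1.
exact: eqmod_sym.
Qed.

Lemma zeta_subgroup n : add_subgroup (zeta mul n).
Proof. by case: (zeta_closed n). Qed.

Lemma zeta_starl n a x : zeta mul n a -> zeta mul n (a ** x).
Proof. by case: (zeta_closed n) => _ cZ /(cZ _ x) []. Qed.

Lemma zeta_starr n a x : zeta mul n a -> zeta mul n (x ** a).
Proof. by case: (zeta_closed n) => _ cZ /(cZ _ x) []. Qed.

Lemma zetaS n a : zeta mul n a -> zeta mul n.+1 a.
Proof. by move=> Za x; split; [apply: zeta_starl | apply: zeta_starr]. Qed.

Lemma zeta_pred_star n a x :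
  zeta mul n a -> zeta mul n.-1 (a ** x) /\ zeta mul n.-1 (x ** a).
Proof.
by case: n => [->|n Za]; [rewrite star0r starr0 | apply: Za].
Qed.

Lemma zeta_shift n u w x : zeta mul n w -> zeta mul n.-1 ((u + w) ** x - u ** x).
Proof.
move=> Zw; apply: (star_shift (I := zeta mul n)) => //.
- exact: zeta_subgroup.
- exact: zeta_subgroup.
- by move=> a v; apply: zeta_starr.
- by move=> v a /(zeta_pred_star a) [].
- by move=> a v; apply: zeta_starr.
Qed.

Lemma star_set_subgroup (K L : A -> Prop) : add_subgroup (star_set mul K L).
Proof. exact: add_gen_subgroup. Qed.

Lemma mem_star_set (K L : A -> Prop) x y : K x -> L y -> star_set mul K L (x ** y).
Proof. by move=> Kx Ly H hH; apply; exists x, y. Qed.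

Lemma star_set_min (K L H : A -> Prop) : add_subgroup H ->
  (forall x y, K x -> L y -> H (x ** y)) -> forall z, star_set mul K L z -> H z.
Proof. by move=> hH KLH z; apply=> // _ [x [y [Kx [Ly ->]]]]; apply: KLH. Qed.

End BraceArithmetic.

(** * Biadditivity of star modulo a layer *)

Section Layers.

Variables (A : zmodType) (mul : A -> A -> A) (one : A) (inv : A -> A).
Hypothesis HB : is_brace mul one inv.

Local Notation "a ** b" := (star mul a b) (at level 40, left associativity).

(* Modulo [J] the subgroup [I] is central, and [M] is central modulo [I]: hence
   the star product is biadditive modulo [J] as soon as one argument is in [M]. *)
Record layer (M I J : A -> Prop) : Prop := Layer {
  layM : add_subgroup M;
  layI : add_subgroup I;
  layJ : add_subgroup J;
  layIM : forall x, I x -> M x;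
  layMI : forall x y, M x -> I (x ** y) /\ I (y ** x);
  layIJ : forall x y, I x -> J (x ** y) /\ J (y ** x);
  layJJ : forall x y, J x -> J (y ** x)
}.

Variables M I J : A -> Prop.
Hypothesis hL : layer M I J.

Lemma layer_star_addl a b x : M b -> J ((a + b) ** x - (a ** x + b ** x)).
Proof.
case: hL => hM hI hJ IM MI IJ JJ Mb.
apply: (star_addl_mod HB (I := I)) => //.
- by move=> u v /IM /(MI _ u) [].
- by move=> u v /(IJ _ v) [].
- by move=> u v /(IJ _ u) [].
- by move=> u v; apply: JJ.
- by case: (MI b a).
- by case: (MI b x).
Qed.

Lemma layer_star_shift u w x : I w -> J ((u + w) ** x - u ** x).
Proof.
case: hL => hM hI hJ IM MI IJ JJ Iw.
apply: (star_shift HB (I := I)) => //.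
- by move=> a v /IM /(MI _ a) [].
- by move=> v a /(IJ _ a) [].
- by move=> a v; apply: JJ.
Qed.

Lemma layer_starMn a x n : M a -> J ((a *+ n) ** x - (a ** x) *+ n).
Proof.
have hJ := layJ hL; move=> Ma; elim: n => [|n IHn].
  by rewrite !mulr0n (star0r HB) subrr; apply: hJ.1.
rewrite !mulrSr; apply: eqmod_trans (hJ) (layer_star_addl _ _ Ma) _.
by apply: eqmodD => //; rewrite subrr; apply: hJ.1.
Qed.

Lemma layer_starMz a x n : M a -> J ((a *~ n) ** x - (a ** x) *~ n).
Proof.
have hJ := layJ hL; move=> Ma; case: n => n; first exact: layer_starMn.
rewrite NegzE !mulrNz -!pmulrn; set m := a *+ n.+1.
have Mm : M m by apply: subgroupMn => //; apply: layM hL.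
(* Additivity applied to [- m + m = 0] handles the sign. *)
apply: (eqmod_trans (y := - (m ** x))) => //.
  have := layer_star_addl (- m) x Mm; rewrite addNr (star0r HB).
  have -> : 0 - ((- m) ** x + m ** x) = - ((- m) ** x - - (m ** x)) by zmod.
  by move/(subgroupN hJ); rewrite opprK.
rewrite -opprD; apply: subgroupN => //; exact: layer_starMn.
Qed.

Lemma layer_star_span a b u v n m : M a -> M b ->
  I (u - a *~ n) -> I (v - b *~ m) -> J (u ** v - (a ** b) *~ (n * m)).
Proof.
case: (hL) => hM hI hJ IM MI IJ JJ Ma Mb Iu Iv.
have := layer_star_shift (a *~ n) v Iu; rewrite subrKC => h.
apply: eqmod_trans (hJ) h _.
apply: (eqmod_trans (y := (a *~ n) ** (b *~ m))) => //.
  by rewrite -(starBr HB); case: (IJ _ (a *~ n) Iv).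
rewrite (starMzr HB) mulrzA; apply: eqmodMz => //; exact: layer_starMz.
Qed.

End Layers.

(** * One-generated subbraces; subbraces as ideals *)

Section NilpotentBrace.

Variables (A : zmodType) (mul : A -> A -> A) (one : A) (inv : A -> A).
Hypothesis HB : is_brace mul one inv.
Variable k : nat.
Hypothesis hzk : forall a, zeta mul k a.

Local Notation "a ** b" := (star mul a b) (at level 40, left associativity).
Local Notation subbrace := (subbrace mul one inv).

(* The inverse of [x] solves [u = - x - x ** u], and iterating this equation
   converges because left star multiplication is nilpotent. *)
Lemma star_closed_subbrace (S : A -> Prop) : add_subgroup S ->
  (forall x y, S x -> S y -> S (x ** y)) -> subbrace S.
Proof.
move=> hS SS; split=> //; split; first by rewrite (brace_one HB); apply: hS.1.
split=> [x y Sx Sy|x Sx].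
  rewrite brace_mulE; apply: subgroupD => //; last exact: SS.
  exact: subgroupD.
have approx j : exists2 s, S s & zeta mul (k - j) (inv x - s).
  elim: j => [|j [s Ss Zs]].
    by exists 0; [apply: hS.1 | rewrite subn0; apply: hzk].
  exists (- x - x ** s); first by apply: subgroupB; [|apply: subgroupN|apply: SS].
  rewrite subnS; have -> : inv x - (- x - x ** s) = - (x ** (inv x - s)).
    by rewrite (starBr HB) (star_inv HB); zmod.
  apply: subgroupN; first exact: (zeta_subgroup HB).
  by case: (zeta_pred_star HB x Zs).
have [s Ss] := approx k; rewrite subnn => /= /eqP.
by rewrite subr_eq0 => /eqP ->.
Qed.

Lemma subbrace_star (L : A -> Prop) x y : subbrace L -> L x -> L y -> L (x ** y).
Proof.
move=> [hL [_ [Lmul _]]] Lx Ly; rewrite /star.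
by apply: subgroupB => //; apply: subgroupB => //; apply: Lmul.
Qed.

Definition cyc a y := forall L, subbrace L -> L a -> L y.

Lemma cyc_subgroup a : add_subgroup (cyc a).
Proof.
split=> [L [hL _] _|x y Cx Cy L sL La]; first exact: hL.1.
by apply: subgroupB sL.1 (Cx _ sL La) (Cy _ sL La).
Qed.

Lemma cyc_star a x y : cyc a x -> cyc a y -> cyc a (x ** y).
Proof.
by move=> Cx Cy L sL La; apply: subbrace_star => //; [apply: Cx | apply: Cy].
Qed.

Lemma cyc_id a : cyc a a. Proof. by move=> L. Qed.

Lemma cyc_subbrace a : subbrace (cyc a).
Proof.
by apply: star_closed_subbrace; [apply: cyc_subgroup | apply: cyc_star].
Qed.

Lemma cyc_min a (S : A -> Prop) : add_subgroup S ->
  (forall x y, S x -> S y -> S (x ** y)) -> S a -> forall y, cyc a y -> S y.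
Proof. by move=> hS SS Sa y; apply=> //; apply: star_closed_subbrace. Qed.

Definition cyc_sq a := star_set mul (cyc a) (cyc a).

Lemma cyc_sq_subgroup a : add_subgroup (cyc_sq a).
Proof. exact: star_set_subgroup. Qed.

(** Minimality of [cyc a] is applied to a set that also records [cyc a z], since a product is known
    to lie in [cyc_sq a] only when both factors lie in [cyc a]. *)
Lemma cyc_decomp a y : cyc a y -> mod_span (cyc_sq a) a y.
Proof.
have hD := cyc_sq_subgroup a.
move=> /(@cyc_min a (fun z => cyc a z /\ mod_span (cyc_sq a) a z)) [] //.
- split=> [|x z [Cx Sx] [Cz Sz]].
    by split; [apply: (cyc_subgroup a).1 | apply: (mod_span_subgroup _ hD).1].
  split; first exact: subgroupB (cyc_subgroup a) Cx Cz.
  by apply: subgroupB => //; apply: mod_span_subgroup.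
- move=> x z [Cx _] [Cz _]; split; first exact: cyc_star.
  by apply: mod_span_sub; apply: mem_star_set.
- by split; [apply: cyc_id | apply: mod_span_id].
Qed.

Lemma layer_cyc (M I J : A -> Prop) a y : layer mul M I J -> M a -> cyc a y ->
  M y /\ mod_span I a y.
Proof.
case=> hM hI hJ IM MI IJ JJ Ma.
apply: (@cyc_min a (fun z => M z /\ mod_span I a z)).
- split=> [|x z [Mx Sx] [Mz Sz]].
    by split; [apply: hM.1 | apply: (mod_span_subgroup _ hI).1].
  split; first exact: subgroupB hM Mx Mz.
  by apply: subgroupB => //; apply: mod_span_subgroup.
- move=> x z [Mx _] _; have [Ixz _] := MI x z Mx.
  by split; [apply: IM | apply: mod_span_sub].
- by split; [| apply: mod_span_id].
Qed.

(** Elements of [cyc a] are multiples of [a] modulo [I], so by biadditivity their products are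
    multiples of [a ** a] modulo [J]. *)
Lemma layer_cyc_sq (M I J : A -> Prop) a y : layer mul M I J -> M a ->
  cyc_sq a y -> I y /\ mod_span J (a ** a) y.
Proof.
move=> hL Ma; have [hM hI hJ IM MI IJ JJ] := hL.
apply: (star_set_min (H := fun z => I z /\ mod_span J (a ** a) z)).
  split=> [|x z [Ix Sx] [Iz Sz]].
    by split; [apply: hI.1 | apply: (mod_span_subgroup _ hJ).1].
  split; first exact: subgroupB hI Ix Iz.
  by apply: subgroupB => //; apply: mod_span_subgroup.
move=> u v Cu Cv; have [Mu [n Iu]] := layer_cyc hL Ma Cu.
have [_ [m Iv]] := layer_cyc hL Ma Cv.
split; first by case: (MI u v Mu).
by exists (n * m); apply: (layer_star_span HB hL).
Qed.

Definition zeta_hull (L : A -> Prop) i y := exists2 l, L l & zeta mul i (y - l).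

(** Makes each hull [L + zeta i] an ideal of the next one: replacing [x] by [l] and then [y] by [m]
    changes the products only modulo [zeta i]. *)
Lemma zeta_hull_star (L : A -> Prop) i x y : subbrace L ->
  zeta_hull L i.+1 x -> zeta_hull L i y ->
  zeta_hull L i (x ** y) /\ zeta_hull L i (y ** x).
Proof.
move=> sL [l Ll Zx] [m Lm Zy]; have hZ := zeta_subgroup HB i.
have Llm := subbrace_star sL Ll Lm; have Lml := subbrace_star sL Lm Ll.
split; [exists (l ** m) => // | exists (m ** l) => //].
  have := zeta_shift HB l y Zx; rewrite subrKC /= => h.
  apply: eqmod_trans (hZ) h _; rewrite -(starBr HB); exact: (zeta_starr HB).
apply: (eqmod_trans (y := m ** x)) => //.
  have := zeta_shift HB m x (zetaS HB Zy); rewrite subrKC; exact.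
by rewrite -(starBr HB); case: (zeta_pred_star HB m Zx).
Qed.

Lemma zeta_hull_sub (L : A -> Prop) i x : L x -> zeta_hull L i x.
Proof. by exists x => //; rewrite subrr; apply: (zeta_subgroup HB i).1. Qed.

Lemma zeta_hullS (L : A -> Prop) i x : zeta_hull L i x -> zeta_hull L i.+1 x.
Proof. by case=> l Ll Zx; exists l => //; apply: (zetaS HB). Qed.

Lemma zeta_hull_subgroup (L : A -> Prop) i :
  subbrace L -> add_subgroup (zeta_hull L i).
Proof.
move=> [hL _]; split; first by apply: zeta_hull_sub; apply: hL.1.
move=> x y [l Ll Zx] [m Lm Zy]; exists (l - m); first exact: subgroupB.
have -> : x - y - (l - m) = (x - l) - (y - m) by zmod.
by apply: subgroupB => //; apply: (zeta_subgroup HB).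
Qed.

Lemma zeta_hull_subbrace (L : A -> Prop) i :
  subbrace L -> subbrace (zeta_hull L i).
Proof.
move=> sL; apply: star_closed_subbrace; first exact: zeta_hull_subgroup.
by move=> x y /zeta_hullS Hx Hy; case: (zeta_hull_star sL Hx Hy).
Qed.

(* Every subbrace is a subideal through the hulls [L + zeta_i]. *)
Lemma T_brace_subbrace_ideal (L : A -> Prop) a z :
  T_brace mul one inv -> subbrace L -> L z -> L (a ** z) /\ L (z ** a).
Proof.
move=> HT sL Lz.
have hull j : ideal mul one inv (zeta_hull L (k - j)).
  elim: j => [|j IHj].
    have full x : zeta_hull L (k - 0) x.
      by exists 0; [apply: sL.1.1 | rewrite subn0; apply: hzk].
    by split; [apply: zeta_hull_subbrace | split].
  have [lt_jk|le_kj] := ltnP j k; last first.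
    by move: IHj; rewrite subnS; case: (k - j)%N (subn_eq0 k j) => //; rewrite le_kj.
  apply: HT IHj; split; first exact: zeta_hull_subbrace.
  have e : (k - j = (k - j.+1).+1)%N by rewrite subnSK.
  split=> [x|x y Hx Hy]; first by rewrite e; apply: zeta_hullS.
  by apply: zeta_hull_star => //; rewrite -e.
have hull0 x : zeta_hull L 0 x -> L x.
  by case=> l Ll /eqP; rewrite subr_eq0 => /eqP ->.
have [_ [_]] := hull k; rewrite subnn => /(_ a z) [] //.
  exact: zeta_hull_sub.
by split; apply: hull0.
Qed.

End NilpotentBrace.

(** * Torsion of star products and their place in [cyc_sq a] *)

Section DedekindBrace.

Variables (A : zmodType) (mul : A -> A -> A) (one : A) (inv : A -> A).
Hypothesis HB : is_brace mul one inv.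
Variable k : nat.
Hypothesis hzk : forall a, zeta mul k a.
Hypothesis HT : T_brace mul one inv.

Local Notation "a ** b" := (star mul a b) (at level 40, left associativity).
Local Notation subbrace := (subbrace mul one inv).
Local Notation cyc := (cyc mul one inv).
Local Notation cyc_sq := (cyc_sq mul one inv).
Local Notation zeta := (zeta mul).

Lemma cyc_ideal a x y : cyc a y -> cyc a (x ** y) /\ cyc a (y ** x).
Proof.
move=> Cy; apply: (T_brace_subbrace_ideal HB hzk) => //.
exact: (cyc_subbrace HB hzk).
Qed.

(** Write [y] as a multiple [a *~ n] plus an element of [cyc_sq a]; then [a *~ n] lies in [H], which
    forces [n = 0]. *)
Lemma cyc_in_sq (H : A -> Prop) a y : add_subgroup H ->
  (forall d, cyc_sq a d -> H d) -> (forall n : int, n != 0 -> ~ H (a *~ n)) ->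
  cyc a y -> H y -> cyc_sq a y.
Proof.
move=> hH DH aH /(cyc_decomp HB hzk) [n Dy] Hy.
have Ha : H (a *~ n).
  by apply: (eqmod_in (y := y)) => //; apply: eqmod_sym => //; apply: DH.
have [n0|/aH //] := eqVneq n 0.
by move: Dy; rewrite n0 mulr0z subr0.
Qed.

Lemma zeta_star_torsion i a x :
  zeta i a -> torsion (a ** x) /\ torsion (x ** a).
Proof.
have hT := torsion_subgroup A; elim: i a x => [a x ->|i IHi a x].
  by rewrite (star0r HB) (starr0 HB); split; apply: hT.1.
have hL : layer mul (zeta i.+1) (zeta i) (@torsion A).
  split=> //; try exact: (zeta_subgroup HB); first by move=> b; apply: (zetaS HB).
  by move=> b y [n [n_gt0 nb]]; exists n; rewrite -(starMnr HB) nb (starr0 HB).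
(* When [b] has infinite order modulo [zeta i], its products lie in [cyc b] and in [zeta i], hence
   in [cyc_sq b]. *)
have in_span b y : zeta i.+1 b -> (forall n : int, n != 0 -> ~ zeta i (b *~ n)) ->
    mod_span (@torsion A) (b ** b) (b ** y) /\
    mod_span (@torsion A) (b ** b) (y ** b).
  move=> Zb b_free; have [Zby Zyb] := Zb y.
  have [Cyb Cby] := cyc_ideal y (@cyc_id _ mul one inv b).
  have DZ d : cyc_sq b d -> zeta i d by case/(layer_cyc_sq HB hzk hL Zb).
  have hZ := zeta_subgroup HB i.
  by split; apply: (proj2 (layer_cyc_sq HB hzk hL Zb _)); apply: (cyc_in_sq hZ).
move=> Za.
(* If a nonzero multiple of [a] falls into [zeta i], the induction hypothesis applies to it and the
   factor [n] is cancelled. *)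
have [[n [n_neq0 Zna]]|a_free] := classic (exists n : int, n != 0 /\ zeta i (a *~ n)).
  have [Tnax Txna] := IHi _ x Zna; split; last first.
    by move: Txna; rewrite (starMzr HB); apply: torsionMz.
  apply: (torsionMz n_neq0); apply: eqmod_in (hT) _ Tnax.
  by apply: eqmod_sym => //; apply: (layer_starMz HB hL).
have free n : n != 0 -> ~ zeta i (a *~ n).
  by move=> n_neq0 Zna; apply: a_free; exists n.
have free2 n : n != 0 -> ~ zeta i (a *~ 2 *~ n).
  by move=> n_neq0; rewrite -mulrzA; apply: free; lia.
set c := a ** a.
(* Take [b = 2a] and [y = a] in [in_span]: modulo torsion [2c] equals [4tc], and [2 - 4t] is never
   zero. *)
have Tc : torsion c.
  have Z2a : zeta i.+1 (a *~ 2) by apply: (subgroupMz 2 (zeta_subgroup HB i.+1) Za).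
  have [[t Ht] _] := in_span _ a Z2a free2.
  have T2 := layer_starMz HB hL a 2 Za; rewrite -/c in T2.
  apply: (@torsionMz _ _ (2 - 2 * 2 * t)); first lia.
  rewrite mulrzBr !mulrzA; rewrite (starMzr HB) in Ht.
  apply: eqmod_in (hT) _ Ht; set P := (a *~ 2) ** a.
  have -> : c *~ 2 - c *~ 2 *~ 2 *~ t - (P - P *~ 2 *~ t)
    = (P *~ 2 *~ t - c *~ 2 *~ 2 *~ t) - (P - c *~ 2) by zmod.
  by apply: subgroupB => //; do 2!apply: eqmodMz => //.
have span_torsion y : mod_span (@torsion A) c y -> torsion y.
  by case=> t Ty; apply: (eqmod_in hT Ty); apply: subgroupMz.
by have [/span_torsion Tax /span_torsion Txa] := in_span _ x Za free.
Qed.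

Lemma star_torsion a x : torsion (a ** x).
Proof. by case: (zeta_star_torsion x (hzk a)). Qed.

Lemma star_set_torsion K L y : star_set mul K L y -> torsion y.
Proof.
by apply: star_set_min; [apply: torsion_subgroup | move=> *; apply: star_torsion].
Qed.

Lemma cyc_in_sq_torsion a y : ~ torsion a -> cyc a y -> torsion y -> cyc_sq a y.
Proof.
move=> Ta; apply: (cyc_in_sq (torsion_subgroup A)).
  by move=> d; apply: star_set_torsion.
by move=> n n_neq0 /(torsionMz n_neq0).
Qed.

Lemma cyc_sq_star_nontorsion a x :
  ~ torsion a -> cyc_sq a (a ** x) /\ cyc_sq a (x ** a).
Proof.
move=> Ta; have [Cxa Cax] := cyc_ideal x (@cyc_id _ mul one inv a).
by split; apply: cyc_in_sq_torsion => //; apply: star_torsion.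
Qed.

(** If [zeta 1] were torsion, so would be every [zeta i]. For [z] of infinite order in [zeta i.+2],
    let [e] kill [z ** z]; then [e] sends [cyc_sq z], which contains all products with [z], into
    [zeta i]. So [z *+ e] lies in [zeta i.+1], which is torsion by induction. *)
Lemma nontorsion_center :
  ~ add_periodic A -> exists2 z, zeta 1 z & ~ torsion z.
Proof.
move=> nper; apply: NNPP => no_z; apply: nper => a.
have Z1 z : zeta 1 z -> torsion z.
  by move=> Zz; apply: NNPP => Tz; apply: no_z; exists z.
suff zeta_torsion i z : zeta i z -> torsion z by apply: zeta_torsion (hzk a).
elim: i z => [z /(zetaS HB)|]; first exact: Z1.
case=> [|i] IHi z; first exact: Z1.
move=> Zz; apply: NNPP => Tz.
have hL : layer mul (zeta i.+2) (zeta i.+1) (zeta i).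
  split; try exact: (zeta_subgroup HB).
  - by move=> y; apply: (zetaS HB).
  - by move=> y w; apply.
  - by move=> y w; apply.
  - by move=> y w; apply: (zeta_starr HB).
have [e [e_gt0 ec]] := star_torsion z z.
have ann y : cyc_sq z y -> zeta i (y *+ e).
  case/(layer_cyc_sq HB hzk hL Zz) => _ [n /(subgroupMn e (zeta_subgroup HB i))].
  have ecn : (z ** z) *~ n *+ e = 0 by rewrite pmulrn mulrzAC -pmulrn ec mul0rz.
  by rewrite mulrnBl ecn subr0.
apply: (Tz); apply: (torsionMn e_gt0); apply: IHi => x.
have [/ann Zzx /ann Zxz] := cyc_sq_star_nontorsion x Tz.
split; last by rewrite (starMnr HB).
apply: (eqmod_in (zeta_subgroup HB i)) Zzx.
exact: (layer_starMn HB hL).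
Qed.

Lemma zeta1_star_addl u w x : zeta 1 w -> (u + w) ** x = u ** x.
Proof. by move=> Zw; apply/eqP; rewrite -subr_eq0; apply/eqP; apply: (zeta_shift HB u x Zw). Qed.

Lemma zeta1_star_addr u w x : zeta 1 w -> x ** (u + w) = x ** u.
Proof. by case/(_ x) => _; rewrite (starDr HB) => ->; rewrite addr0. Qed.

(** The subbrace generated by [a + z] lies in [cyc a + zeta 1], and the central summands do not
    affect star products. *)
Lemma cyc_sq_zeta1 a z y : zeta 1 z -> cyc_sq (a + z) y -> cyc_sq a y.
Proof.
move=> Zz; have sC := cyc_subbrace HB hzk a.
have sub u : cyc (a + z) u -> zeta_hull mul (cyc a) 1 u.
  apply; first exact: zeta_hull_subbrace.
  by exists a; [apply: cyc_id | rewrite addrC addKr].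
apply: star_set_min; first exact: cyc_sq_subgroup.
move=> u v /sub [l Cl Zu] /sub [m Cm Zv].
rewrite -(subrKC l u) -(subrKC m v) zeta1_star_addl // zeta1_star_addr //.
exact: mem_star_set.
Qed.

(* Adding a central element of infinite order to [a] changes neither its star
   products nor [cyc_sq a], and makes it torsion-free over the torsion part. *)
Lemma cyc_sq_star a x :
  ~ add_periodic A -> cyc_sq a (a ** x) /\ cyc_sq a (x ** a).
Proof.
case/nontorsion_center=> z Zz Tz.
have [Ta|/cyc_sq_star_nontorsion //] := classic (torsion a).
have Taz : ~ torsion (a + z).
  move=> Taz; apply: Tz; rewrite -(addKr a z) addrC.
  exact: subgroupB (torsion_subgroup A) Taz Ta.
have [] := cyc_sq_star_nontorsion x Taz.
by rewrite zeta1_star_addl // zeta1_star_addr // => /cyc_sq_zeta1 ? /cyc_sq_zeta1 ?; split; auto.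
Qed.

End DedekindBrace.

(** * Working up to multipliers prime to [p] *)

Section PrimeToP.

Variables (A : zmodType) (p : nat).
Hypothesis p_pr : prime p.
Implicit Types (H N : A -> Prop) (x y c d : A).

Lemma subgroup_coprime H y (s t : int) : add_subgroup H -> coprimez s t ->
  H (y *~ s) -> H (y *~ t) -> H y.
Proof.
move=> hH /eqP st Hs Ht; have [u [v e]] := Bezoutz s t.
have -> : y = y *~ s *~ u + y *~ t *~ v.
  by rewrite -!mulrzA -mulrzDr ![_ * u]mulrC ![_ * v]mulrC e st mulr1z.
by apply: subgroupD => //; apply: subgroupMz.
Qed.

(** For a subgroup [N], the kernel of the map from [A] to the localization of [A / N] at [p];
    congruence modulo it sees only what happens at [p]. *)
Definition p'_closure N y := exists2 m : nat, coprime p m & N (y *+ m).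

Lemma p'_closure_sub N y : N y -> p'_closure N y.
Proof. by exists 1%N; [apply: coprimen1 | rewrite mulr1n]. Qed.

Lemma p'_closure_subgroup N : add_subgroup N -> add_subgroup (p'_closure N).
Proof.
move=> hN; split=> [|x y [m pm Nx] [n pn Ny]].
  by apply: p'_closure_sub; apply: hN.1.
exists (m * n)%N; first by rewrite coprimeMr pm.
rewrite mulrnBl mulrnA [(m * n)%N]mulnC mulrnA.
by apply: subgroupB => //; apply: subgroupMn.
Qed.

Lemma p'_closureMz N y (s : int) : coprimez p s -> add_subgroup N ->
  p'_closure N (y *~ s) -> p'_closure N y.
Proof.
move=> ps hN [m pm Nym]; exists (`|s| * m)%N.
  by rewrite coprimeMr pm andbT.
rewrite mulrnA; case: s ps Nym => n _ //=.
by rewrite NegzE mulrNz mulNrn => /(subgroupN hN); rewrite opprK.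
Qed.

Definition p_torsion x := exists e : nat, x *+ (p ^ e) = 0.

Lemma p_torsion_subgroup : add_subgroup p_torsion.
Proof.
split=> [|x y [e xe] [f yf]]; first by exists 0%N; rewrite mul0rn.
exists (e + f)%N; rewrite expnD mulrnBl mulrnA xe mul0rn.
by rewrite mulnC mulrnA yf mul0rn subr0.
Qed.

Lemma p_torsion_closure N y :
  add_subgroup N -> p'_closure N y -> p_torsion y -> N y.
Proof.
move=> hN [m pm Nym] [e ye].
apply: (@subgroup_coprime N y m (p ^ e)%N) => //.
  by rewrite coprimezE /= coprime_sym coprimeXl.
by rewrite -pmulrn ye; apply: hN.1.
Qed.

Lemma torsion_p_part x :
  torsion x -> exists2 m : nat, coprime p m & p_torsion (x *+ m).
Proof.
case=> n [n_gt0 xn]; have [m pm e] := pfactor_coprime p_pr n_gt0.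
by exists m => //; exists (logn p n); rewrite -mulrnA -e.
Qed.

(** Modulo the closure, [y] is [s] times an element [d] killed by [p]. Either [p] divides [s] and
    [y] vanishes, or [s] is invertible modulo [p] and [d] is recovered from [y]. *)
Lemma p'_closure_dichotomy N y d (s : int) : add_subgroup N ->
  p'_closure N (d *+ p) -> p'_closure N (y - d *~ s) ->
  p'_closure N y \/
  (forall H, add_subgroup H -> (forall z, p'_closure N z -> H z) -> H y -> H d).
Proof.
move=> hN Ndp Nyd; have hN' := p'_closure_subgroup hN.
have [ps|ps] := boolP (coprimez p s); [right=> H hH NH Hy | left].
  apply: (subgroup_coprime hH ps); first by rewrite -pmulrn; apply: NH.
  by apply: eqmod_in (hH) _ Hy; apply: NH; apply: eqmod_sym.
apply: (eqmod_in hN' Nyd); have [r ->] : exists r, s = p%:Z * r.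
  have : (p %| s)%Z by rewrite dvdzE; apply: contraR ps; rewrite -prime_coprime.
  by case/dvdzP=> r ->; exists r; rewrite mulrC.
by rewrite mulrzA -pmulrn; apply: subgroupMz.
Qed.

End PrimeToP.

(** * The derived series and the order of its [p]-parts *)

Section DerivedSeries.

Variables (A : zmodType) (mul : A -> A -> A) (one : A) (inv : A -> A).
Hypothesis HB : is_brace mul one inv.
Variable k : nat.
Hypothesis hzk : forall a, zeta mul k a.
Hypothesis HT : T_brace mul one inv.
Hypothesis hnp : ~ add_periodic A.
Variable p : nat.
Hypothesis p_pr : prime p.

Local Notation "a ** b" := (star mul a b) (at level 40, left associativity).
Local Notation subbrace := (subbrace mul one inv).
Local Notation cyc_sq := (cyc_sq mul one inv).
Local Notation zeta := (zeta mul).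

Fixpoint derived n : A -> Prop :=
  match n with 0%N => @setA A | n'.+1 => star_set mul (derived n') (derived n') end.

Lemma derived_subgroup n : add_subgroup (derived n).
Proof. by case: n => [|n]; [split | apply: star_set_subgroup]. Qed.

Lemma derived_subbrace n : subbrace (derived n).
Proof.
apply: (star_closed_subbrace HB hzk); first exact: derived_subgroup.
elim: n => [//|n IHn] x y.
have sub : forall z, derived n.+1 z -> derived n z.
  by apply: star_set_min; first exact: derived_subgroup.
by move=> /sub Dx /sub Dy; apply: mem_star_set.
Qed.

Lemma derivedS n x : derived n.+1 x -> derived n x.
Proof.
apply: star_set_min; first exact: derived_subgroup.
by move=> u v; apply: subbrace_star; apply: derived_subbrace.
Qed.

(** The second factor is arbitrary: both products lie in [cyc_sq a], and [cyc a] is contained in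
    [derived n]. *)
Lemma derived_star n a x :
  derived n a -> derived n.+1 (a ** x) /\ derived n.+1 (x ** a).
Proof.
move=> Da; have sub y : cyc_sq a y -> derived n.+1 y.
  apply: star_set_min; first exact: derived_subgroup.
  move=> u v Cu Cv.
  by apply: mem_star_set; [apply: Cu|apply: Cv] => //; apply: derived_subbrace.
by case: (cyc_sq_star HB hzk HT a x hnp); split; apply: sub.
Qed.

Lemma derived_zeta n x : derived n x -> zeta (k - n) x.
Proof.
elim: n x => [|n IHn] x; first by rewrite subn0.
move: x; apply: star_set_min; first exact: (zeta_subgroup HB).
move=> u v /IHn Zu _; rewrite subnS; by case: (zeta_pred_star HB v Zu).
Qed.

Lemma derived_torsion n x : derived n.+1 x -> torsion x.
Proof. exact: (star_set_torsion HB hzk HT). Qed.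

Lemma derived_layer n :
  layer mul (derived n) (derived n.+1) (derived n.+2).
Proof.
split; try exact: derived_subgroup.
- exact: derivedS.
- by move=> x y; apply: derived_star.
- by move=> x y; apply: derived_star.
- by move=> x y Dx; apply: derivedS; case: (derived_star y Dx).
Qed.

(** After localization at [p], the quotient of [derived n] by [derived n.+1] is cyclic of order
    dividing [p]. *)
Definition p_cyclic_layer n := exists c, [/\ derived n c,
  p'_closure p (derived n.+1) (c *+ p) &
  forall y, derived n y -> mod_span (p'_closure p (derived n.+1)) c y].

Lemma p_cyclic_layerS n : p_cyclic_layer n -> p_cyclic_layer n.+1.
Proof.
case=> c [Dc [m pm Dcpm] gen_c].
have hL := derived_layer n; have hN := derived_subgroup n.+2.
have hN' := p'_closure_subgroup p hN.
exists (c ** c); split; first by case: (derived_star c Dc).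
  exists m => //; rewrite -!(starMnr HB).
  by case: (derived_star c Dcpm).
apply: (star_set_min (mod_span_subgroup (c ** c) hN')).
move=> u v Du Dv; have [i [m1 pm1 Hu]] := gen_c _ Du.
have [j [m2 pm2 Hv]] := gen_c _ Dv.
(* [m1] and [m2] clear the denominators of [u] and [v], giving honest congruences modulo
   [derived n.+1], where biadditivity applies. *)
exists (i * j), (m1 * m2)%N; first by rewrite coprimeMr pm1.
have Hu' : derived n.+1 (u *~ m1 - c *~ (i * m1)).
  by rewrite mulrzA -mulrzBl -pmulrn.
have Hv' : derived n.+1 (v *~ m2 - c *~ (j * m2)).
  by rewrite mulrzA -mulrzBl -pmulrn.
have E1 := layer_star_span HB hL Dc Dc Hu' Hv'.
have D0 w : derived n.+1 (w - w) by rewrite subrr; apply: (derived_subgroup n.+1).1.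
have E2 := layer_star_span HB hL Du Dv (D0 (u *~ m1)) (D0 (v *~ m2)).
rewrite pmulrn mulrzBl -!mulrzA PoszM mulrACA.
exact: eqmod_trans (hN) (eqmod_sym hN E2) E1.
Qed.

Lemma derived_span_sq a x :
  mod_span (derived 2) (a ** a) (a ** x) /\ mod_span (derived 2) (a ** a) (x ** a).
Proof.
have h y : cyc_sq a y -> mod_span (derived 2) (a ** a) y.
  by move=> Cy; case: (layer_cyc_sq HB hzk (derived_layer 0) (a := a) I Cy).
by case: (cyc_sq_star HB hzk HT a x hnp) => /h ? /h ?.
Qed.

(** Put [c = a ** a]. Since [(p a) ** a] is a multiple of [(p a) ** (p a)], biadditivity gives that
    [pc] equals [p^2 t c] modulo [derived 2], and [1 - pt] is prime to [p]. *)
Lemma derived_sq_exponent a : p'_closure p (derived 2) ((a ** a) *+ p).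
Proof.
have hL := derived_layer 0; have hN := derived_subgroup 2.
have [[t Ht] _] := derived_span_sq (a *~ p) a.
have Hp := layer_starMz HB hL a p (a := a) I.
set P := (a *~ p) ** a in Ht Hp; rewrite (starMzr HB) -/P in Ht.
apply: (p'_closureMz (s := 1 - p%:Z * t)) => //.
  by apply/coprimezP; exists (t, 1) => /=; lia.
apply: p'_closure_sub; rewrite mulrzBr mulr1z mulrzA -!pmulrn.
apply: eqmod_in (hN) _ Ht; rewrite !pmulrn.
set c := a ** a in Hp *.
have -> : c *~ p - c *~ p *~ p *~ t - (P - P *~ p *~ t)
  = (P *~ p *~ t - c *~ p *~ p *~ t) - (P - c *~ p) by zmod.
by apply: (subgroupB hN _ Hp); do 2!apply: (eqmodMz _ hN).
Qed.

Lemma p_cyclic_layer1 : p_cyclic_layer 1.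
Proof.
have hL := derived_layer 0; have hN := derived_subgroup 2.
have hN' := p'_closure_subgroup p hN; set N' := p'_closure p (derived 2) in hN'.
(* Squares suffice, as [u ** v] is a multiple of [u ** u] modulo [derived 2]. *)
have gen c : (forall x, mod_span N' c (x ** x)) ->
    forall y, derived 1 y -> mod_span N' c y.
  move=> gen_c; have hS := mod_span_subgroup c hN'.
  apply: star_set_min => // u v _ _; have [[n Huv] _] := derived_span_sq u v.
  apply: (eqmod_in hS) (subgroupMz n hS (gen_c u)).
  by apply: mod_span_sub; apply: p'_closure_sub.
have [[a Na]|all_in] := classic (exists a, ~ N' (a ** a)); last first.
  exists 0; split; first exact: (derived_subgroup 1).1.
    by rewrite mul0rn; apply: hN'.1.
  apply: (gen 0) => x; apply: mod_span_sub; apply: NNPP => Nx.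
  by apply: all_in; exists x.
set c := a ** a in Na *; have hS := mod_span_subgroup c hN'.
have NS y : N' y -> mod_span N' c y by apply: mod_span_sub.
have exp x := derived_sq_exponent x.
exists c; split; [exact: mem_star_set | exact: (exp a) |].
apply: (gen c) => x; set d := x ** x.
have [[s1 H1] [s2 H2]] := derived_span_sq x a.
have [[t1 K1] [t2 K2]] := derived_span_sq a x.
(* Used for [x ** a] and [a ** x], each a multiple of both [c] and [d]: if one of them is nonzero
   modulo [N'], then [d] is a multiple of [c]. *)
have dich y s : derived 2 (y - d *~ s) -> mod_span N' c y ->
    N' y \/ mod_span N' c d.
  move=> Hyd Sy.
  have [|h] := p'_closure_dichotomy p_pr hN (exp x) (p'_closure_sub p Hyd).
    by left.
  by right; apply: h.
have span2 y t : derived 2 (y - c *~ t) -> mod_span N' c y.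
  by exists t; apply: p'_closure_sub.
have [Nxa|//] := dich _ _ H1 (span2 _ _ K2).
have [Nax|//] := dich _ _ H2 (span2 _ _ K1).
(* Both mixed products now vanish modulo [N'], so [e] is [c + d] there. As [(a + x) ** a] is [c],
   nonzero, and a multiple of [e], the dichotomy makes [e], hence [d], a multiple of [c]. *)
have add u : N' ((a + x) ** u - (a ** u + x ** u)).
  by apply: p'_closure_sub; apply: (layer_star_addl HB hL).
set e := (a + x) ** (a + x).
have [[r Hr] _] := derived_span_sq (a + x) a.
have Nca : N' ((a + x) ** a - c).
  apply: eqmod_trans (hN') (add a) _.
  by have -> : a ** a + x ** a - c = x ** a by rewrite -/c; zmod.
have Ndx : N' ((a + x) ** x - d).
  apply: eqmod_trans (hN') (add x) _.
  by have -> : a ** x + x ** x - d = a ** x by rewrite -/d; zmod.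
have Se : mod_span N' c e.
  have Sca : mod_span N' c ((a + x) ** a).
    by apply: (eqmod_in hS (NS _ Nca)); apply: mod_span_id.
  have [Naxa|h] := p'_closure_dichotomy p_pr hN (exp (a + x)) (p'_closure_sub p Hr).
    by case: Na; apply: (eqmod_in hN') Naxa; apply: eqmod_sym.
  exact: h.
have -> : d = e - c - ((a + x) ** a - c) - ((a + x) ** x - d).
  by rewrite /e (starDr HB); zmod.
apply: subgroupB (hS) _ (NS _ Ndx); apply: subgroupB (hS) _ (NS _ Nca).
by apply: subgroupB (hS) Se _; apply: mod_span_id.
Qed.

Lemma p_cyclic_layer_all n : p_cyclic_layer n.+1.
Proof. by elim: n => [|n]; [apply: p_cyclic_layer1 | apply: p_cyclic_layerS]. Qed.

(** Passes from the localized layer to true [p]-elements: a multiple of [c0] by some [m] prime to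
    [p] is [p]-torsion, and on [p]-torsion elements the closure of a subgroup adds nothing. *)
Lemma p_torsion_layer n : exists c, [/\ sylow_part p (derived n.+1) c,
  derived n.+2 (c *+ p) &
  forall y, sylow_part p (derived n.+1) y ->
    exists2 r, (r < p)%N & sylow_part p (derived n.+2) (y - c *+ r)].
Proof.
have [c0 [Dc0 Nc0 gen]] := p_cyclic_layer_all n.
have hD := derived_subgroup n.+1; have hN := derived_subgroup n.+2.
have hP := p_torsion_subgroup A p.
have [m pm Pc] := torsion_p_part p_pr (derived_torsion Dc0).
set c := c0 *+ m in Pc; have Dc : derived n.+1 c by apply: (subgroupMn m hD Dc0).
have Ncp : derived n.+2 (c *+ p).
  refine (p_torsion_closure hN _ (subgroupMn p hP Pc)).
  rewrite -mulrnA mulnC mulrnA.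
  exact: (subgroupMn m (p'_closure_subgroup p hN) Nc0).
exists c; split=> // y [Dy Py].
have [t Ht] : mod_span (derived n.+2) c y.
  have [t Ht] := gen y Dy; have hS := mod_span_subgroup c hN.
  apply: (@p_torsion_closure _ p (mod_span (derived n.+2) c)) => //.
  exists m => //; exists t; refine (p_torsion_closure hN _ _).
    have -> : y *+ m - c *~ t = (y - c0 *~ t) *+ m.
      by rewrite mulrnBl /c !pmulrn mulrzAC.
    exact: (subgroupMn m (p'_closure_subgroup p hN) Ht).
  exact: subgroupB (hP) (subgroupMn m hP Py) (subgroupMz t hP Pc).
have p_gt0 := prime_gt0 p_pr; have p_neq0 : p%:Z != 0 by lia.
(* [c *+ p] is already in [derived n.+2], so only [t] modulo [p] matters. *)
exists `|t %% p|%Z%N.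
  by rewrite -ltz_nat gez0_abs ?modz_ge0 //; have := ltz_mod t p_neq0; lia.
split; last exact: subgroupB (hP) Py (subgroupMn _ hP Pc).
rewrite pmulrn gez0_abs ?modz_ge0 //.
apply: eqmod_trans (hN) Ht _; rewrite {1}(divz_eq t p) mulrzDr addrK.
by rewrite mulrC mulrzA -pmulrn; apply: (subgroupMz _ hN Ncp).
Qed.

(** [j] counts the layers left before [derived k], which is zero; each contributes a factor of at
    most [p]. *)
Lemma sylow_derived_card n j : (n.+1 + j = k)%N ->
  finite_card_le (sylow_part p (derived n.+1)) (p ^ j).
Proof.
elim: j n => [|j IHj] n e.
  exists [:: 0]; split=> //; split=> // x; rewrite inE; split=> [[Dx _]|/eqP ->].
    by move: (derived_zeta Dx); rewrite -e addn0 subnn => /= ->.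
  by split; [apply: (derived_subgroup n.+1).1 | exists 0%N; rewrite mul0rn].
have [s [_ [mem_s size_s]]] := IHj n.+1 (etrans (addSnnS _ _) e).
have [c [[Dc Pc] Ncp gen]] := p_torsion_layer n.
have hP := p_torsion_subgroup A p.
(* Sums may repeat, for instance when [c] lies in the next term, so duplicates are removed. *)
exists (undup [seq c *+ r + w | r <- iota 0 p, w <- s]); split.
  exact: undup_uniq.
split=> [x|].
  rewrite mem_undup; split=> [/gen [r lt_rp /mem_s s_xr]|].
    apply/allpairsP; exists (r, x - c *+ r).
    by rewrite mem_iota /= add0n lt_rp s_xr subrKC.
  case/allpairsP=> -[r w] /= [_ /mem_s [Dw Pw] ->].
  split; last by apply: subgroupD (hP) (subgroupMn r hP Pc) Pw.
  have hD := derived_subgroup n.+1.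
  exact: subgroupD (hD) (subgroupMn r hD Dc) (derivedS Dw).
apply: leq_trans (size_undup _) _.
by rewrite size_allpairs size_iota expnS leq_mul2l size_s orbT.
Qed.

End DerivedSeries.

Theorem theoremB (A : zmodType) (mul : A -> A -> A) (one : A) (inv : A -> A)
  (HB : is_brace mul one inv) (HT : T_brace mul one inv)
  (HN : smok_nilpotent mul) (k : nat) (hk : (0 < k)%N)
  (hzk : forall a, zeta mul k a) (hzk1 : ~ (forall a, zeta mul k.-1 a))
  (hnp : ~ add_periodic A) (p : nat) (hp : prime p) :
  finite_card_le (sylow_part p (star_set mul (setA (A:=A)) (setA (A:=A))))
    (p ^ k.-1)%N.
Proof.
(* [A * A] is [derived 1] by computation, with [k.-1] layers below it. *)
apply: (sylow_derived_card HB hzk HT hnp hp (n := 0)).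
by rewrite add1n prednK.
Qed.
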